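(* Let $R:[0,\infty)^2\to\mathbb{R}$ be any one of the following functions (with the stated parameter ranges), and let $\{G_t,t\ge 0\}$ be a one-dimensional centered Gaussian process with covariance $\mathbb{E}(G_sG_t)=R(s,t)$: \begin{enumerate} \item $R(t,s)=\frac{\Gamma(1-K)}{K(2-K)}\left[t^{2HK}+s^{2HK}-(t^{2H}+s^{2H})^{K}\right]$ if $K\in(0,1)$, and $R(t,s)=\frac{\Gamma(2-K)}{K(K-1)}\left[(t^{2H}+s^{2H})^{K}-t^{2HK}-s^{2HK}\right]$ if $K\in(1,2)$, where $H\in(0,1)$ and $HK\in(0,1)$; \item $R(s,t)=\frac12\left(s^{2H}+t^{2H}-|t-s|^{2H}\right)$, $H\in(0,1)$; \item $R(s,t)=(t+s)^{2H}-|t-s|^{2H}$, $H\in(0,1)$; \item $R(t,s)=s^{2H}+t^{2H}-\frac12\left((s+t)^{2H}+|t-s|^{2H}\right)$, $H\in(0,1)$; \item $R(s,t)=(s+t)^{2H}-(\max(s,t))^{2H}$, $H\in(0,\frac12)$; \item $R(s,t)=(\max(s,t))^{2H}-|t-s|^{2H}$, $H\in(0,\frac12)$; \item $R(t,s)=\frac12\left[t^{2H}+s^{2H}-K(t+s)^{2H}-(1-K)|t-s|^{2H}\right]$, $H\in(0,\frac12)$, $K\in(0,1)$; \item $R(t,s)=\frac{1}{2^K}\left((s^{2H}+t^{2H})^K-|t-s|^{2HK}\right)$, where either $H\in(0,1)$, $K\in(0,1)$, $HK\in(0,1)$, or $H\in(0,1)$, $K\in(1,2)$, $HK\in(0,1)$;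 \item $R(t,s)=(s^{2H}+t^{2H})^{K}-\frac12\left[(t+s)^{2HK}+|t-s|^{2HK}\right]$, where either $H\in(0,1)$, $K\in(1,2)$, $HK\in(0,1)$, or $H\in(0,\frac12)$, $K\in(0,1)$. \end{enumerate} Then $G$ satisfies both of the following: (i) there exist constants $c>0$ and $\beta<2$ such that $\mathbb{E}(G_t^2)\le c\,t^{\beta}$ for all $t\ge 0$; (ii) for every $n\ge1$ and all times $0<t_1<t_2<\cdots<t_n$, the covariance matrix $\mathbf{V}=(R(t_i,t_j))_{i,j=1}^n$ is strictly positive definite.
   Context: $\Gamma$ denotes the Euler Gamma function. A symmetric matrix $\mathbf V$ is strictly positive definite if $\mathbf a'\mathbf V\mathbf a>0$ for every nonzero $\mathbf a\in\mathbb{R}^n$. *)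

(* Defs.v *)
From HB Require Import structures.
From mathcomp Require Import all_boot all_order all_algebra.
From mathcomp Require Import all_classical all_reals all_analysis.
Set Implicit Arguments. Unset Strict Implicit. Unset Printing Implicit Defensive.
Import Order.TTheory GRing.Theory Num.Theory.
Local Open Scope classical_set_scope.
Local Open Scope ring_scope.

Definition Gamma {R : realType} (z : R) : R :=
  fine (\int[@lebesgue_measure R]_(x in [set x : R | (0 < x)%R])
          (powR x (z - 1) * expR (- x))%R%:E)%E.

Definition R1 {R : realType} (H K : R) (t s : R) : R :=
  if K < 1 then
    Gamma (1 - K) / (K * (2 - K)) *
      (t `^ (2 * H * K) + s `^ (2 * H * K) - (t `^ (2 * H) + s `^ (2 * H)) `^ K)
  else
    Gamma (2 - K) / (K * (K - 1)) *
      ((t `^ (2 * H) + s `^ (2 * H)) `^ K - t `^ (2 * H * K) - s `^ (2 * H * K)).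
Definition R2 {R : realType} (H : R) (s t : R) : R :=
  2^-1 * (s `^ (2 * H) + t `^ (2 * H) - `|t - s| `^ (2 * H)).
Definition R3 {R : realType} (H : R) (s t : R) : R :=
  (t + s) `^ (2 * H) - `|t - s| `^ (2 * H).
Definition R4 {R : realType} (H : R) (t s : R) : R :=
  s `^ (2 * H) + t `^ (2 * H) - 2^-1 * ((s + t) `^ (2 * H) + `|t - s| `^ (2 * H)).
Definition R5 {R : realType} (H : R) (s t : R) : R :=
  (s + t) `^ (2 * H) - (Num.max s t) `^ (2 * H).
Definition R6 {R : realType} (H : R) (s t : R) : R :=
  (Num.max s t) `^ (2 * H) - `|t - s| `^ (2 * H).
Definition R7 {R : realType} (H K : R) (t s : R) : R :=
  2^-1 * (t `^ (2 * H) + s `^ (2 * H) - K * (t + s) `^ (2 * H)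
          - (1 - K) * `|t - s| `^ (2 * H)).
Definition R8 {R : realType} (H K : R) (t s : R) : R :=
  (2 `^ K)^-1 * ((s `^ (2 * H) + t `^ (2 * H)) `^ K - `|t - s| `^ (2 * H * K)).
Definition R9 {R : realType} (H K : R) (t s : R) : R :=
  (s `^ (2 * H) + t `^ (2 * H)) `^ K
    - 2^-1 * ((t + s) `^ (2 * H * K) + `|t - s| `^ (2 * H * K)).

Definition agrees {R : realType} (Cov f : R -> R -> R) : Prop :=
  forall s t : R, 0 <= s -> 0 <= t -> Cov s t = f s t.

Definition in01 {R : realType} (x : R) : Prop := 0 < x < 1.

Definition cov_family {R : realType} (Cov : R -> R -> R) : Prop :=
  (exists H K : R, in01 H /\ (in01 K \/ 1 < K < 2) /\ in01 (H * K) /\ agrees Cov (R1 H K))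
  \/ (exists H : R, in01 H /\ agrees Cov (R2 H))
  \/ (exists H : R, in01 H /\ agrees Cov (R3 H))
  \/ (exists H : R, in01 H /\ agrees Cov (R4 H))
  \/ (exists H : R, 0 < H < 2^-1 /\ agrees Cov (R5 H))
  \/ (exists H : R, 0 < H < 2^-1 /\ agrees Cov (R6 H))
  \/ (exists H K : R, 0 < H < 2^-1 /\ in01 K /\ agrees Cov (R7 H K))
  \/ (exists H K : R, in01 H /\ (in01 K \/ 1 < K < 2) /\ in01 (H * K) /\ agrees Cov (R8 H K))
  \/ (exists H K : R,
        ((in01 H /\ 1 < K < 2 /\ in01 (H * K)) \/ (0 < H < 2^-1 /\ in01 K))
        /\ agrees Cov (R9 H K)).

Definition pos_def {R : realType} (n : nat) (V : 'M[R]_n) : Prop :=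
  forall a : 'cV[R]_n, a != 0 -> 0 < (a^T *m V *m a) ord0 ord0.

(* Main.v *)
(** The nine covariances are mixtures, over u > 0, of kernels whose positive
    definiteness is visible.  Scaling gives, up to positive constants,
    x^a = int (1 - e^(-xu)) u^(-a-1) du for 0 < a < 1,
    x^a = int (e^(-xu) - 1 + xu) u^(-a-1) du for 1 < a < 2 and
    |x|^a = int (1 - cos(xu)) u^(-a-1) du for 0 < a < 2.
    Hence x^a + y^a - (x+y)^a (0 < a < 1) and its opposite (1 < a < 2) are Gram
    kernels of the functions 1 - e^(-xu), while (t+s)^a - |t-s|^a and the
    sub-fractional kernel are Gram kernels of sin(tu) and 1 - cos(tu);
    strictness is the linear independence of these functions.  Items 1-4 and 7
    are positive combinations of such kernels.  For items 5 and 6 the integrand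
    is, up to a rank-one factor, min(h(s), h(t)) with h increasing.  For items 8
    and 9 with K < 1 the integrand is, up to a rank-one factor, exp(u k) - 1 with
    k one of the kernels above, which is handled by Schur's product theorem; with
    K > 1 they are sums of kernels above. *)
Require Import Defs.
From HB Require Import structures.
From mathcomp Require Import all_boot all_order all_algebra.
From mathcomp Require Import all_classical all_reals all_analysis.
From mathcomp Require Import measurable_realfun ring lra.
Set Implicit Arguments. Unset Strict Implicit. Unset Printing Implicit Defensive.
Import Order.TTheory GRing.Theory Num.Theory.
Import numFieldNormedType.Exports.
Local Open Scope classical_set_scope.
Local Open Scope ring_scope.

(** * Integrals over the line *)

Section Integral.
Context {R : realType}.
Let mu := @lebesgue_measure R.
Implicit Types (G : R -> R) (r c d M : R).

(** Continuity is bundled with integrability so that positivity of a nonnegative integrand at a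
    single point already forces a positive integral. *)
Definition has_int G r :=
  [/\ continuous G, mu.-integrable setT (EFin \o G) & \int[mu]_x G x = r].

Lemma has_int_ext F G r : F =1 G -> has_int F r -> has_int G r.
Proof. by move=> /funext ->. Qed.

Lemma has_intD F G r c : has_int F r -> has_int G c ->
  has_int (fun x => F x + G x) (r + c).
Proof.
move=> [cF iF <-] [cG iG <-]; split.
- by move=> x; apply: continuousD; [exact: cF|exact: cG].
- exact: (integrableD measurableT iF iG).
- by rewrite RintegralD.
Qed.

Lemma has_intZ F r c : has_int F r -> has_int (fun x => c * F x) (c * r).
Proof.
move=> [cF iF <-]; split.
- by move=> x; apply: continuousM; [exact: cst_continuous|exact: cF].
- exact: (integrableZl measurableT c iF).
- by rewrite RintegralZl.
Qed.

Lemma has_int0 : has_int (fun=> 0) 0.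
Proof.
split; [by move=> x; exact: cst_continuous|exact: integrable0|].
by rewrite Rintegral_cst// mul0r.
Qed.

Lemma has_int_sum (I : Type) (s : seq I) (F : I -> R -> R) (r : I -> R) :
  (forall i, has_int (F i) (r i)) ->
  has_int (fun x => \sum_(i <- s) F i x) (\sum_(i <- s) r i).
Proof.
move=> h; elim: s => [|i s ih].
  rewrite big_nil; apply: has_int_ext has_int0 => x; by rewrite big_nil.
rewrite big_cons; apply: has_int_ext (has_intD (h i) ih) => x.
by rewrite big_cons.
Qed.

Lemma has_int_ge0 G r : has_int G r -> (forall x, 0 <= G x) -> 0 <= r.
Proof. by move=> [_ _ <-] h; apply: Rintegral_ge0 => x _; exact: h. Qed.

(** Near [x0] continuity keeps [G] above [G x0 / 2], which bounds the extended integral below by a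
    positive number; integrability keeps it finite, so [fine] preserves the sign. *)
Lemma has_int_gt0 G r : has_int G r -> (forall x, 0 <= G x) ->
  (exists x, 0 < G x) -> 0 < r.
Proof.
move=> [cG iG <-] G0 [x0 Gx0].
have : \forall y \near x0, G x0 / 2 < G y.
  by apply: (cvgr_gt (G x0) (cG x0)); lra.
move=> /nbhs_ballP[e /= e0 he].
pose E := `]x0 - e, x0 + e[%classic.
have mE : measurable E by exact: measurable_itv.
have h : (\int[mu]_(x in E) cst (G x0 / 2)%:E x <=
          \int[mu]_x (G x)%:E)%E.
  apply: (@le_trans _ _ (\int[mu]_(x in E) (G x)%:E)%E).
    apply: ge0_le_integral => //=.
    - by move=> x _; rewrite lee_fin; lra.
    - apply/measurable_EFinP/measurable_funTS; exact: continuous_measurable_fun.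
    - move=> x; rewrite /E /= in_itv /= => xe; rewrite lee_fin ltW//.
      by apply: he; rewrite /ball /= ltr_norml; move: xe; lra.
  apply: ge0_subset_integral => //.
  - by apply/measurable_EFinP; exact: continuous_measurable_fun.
  - by move=> x _; rewrite lee_fin.
rewrite /Rintegral fine_gt0//; apply/andP; split.
  apply: lt_le_trans h.
  rewrite integral_cst// /mu /E /= lebesgue_measure_itv /= lte_fin ifT; last lra.
  by rewrite -EFinD -EFinM lte_fin; apply: mulr_gt0; lra.
by rewrite -ge0_fin_numE ?integral_ge0//; [exact: integrable_fin_num|move=> x _; rewrite lee_fin].
Qed.

(** In the variable v = ln u a translation is a dilation of u; this is the source of the power laws
    below. *)
Lemma has_int_translate G r c : (forall x, 0 <= G x) -> has_int G r ->
  has_int (fun x => G (x + c)) r.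
Proof.
move=> G0 [cG iG rE].
have cGc : continuous (fun x => G (x + c)).
  move=> x; apply: (@continuous_comp _ _ _ (fun x => x + c) G); last exact: cG.
  by apply: continuousD => //; exact: cst_continuous.
have dE (x : R) : is_derive x 1 (fun x : R => x + c) 1.
  by apply: is_derive_eq; rewrite addr0.
have d1 : (fun x : R => x + c)^`()%classic = cst 1.
  by apply/funext => x; rewrite derive1E derive_val.
have E : (\int[mu]_x (G x)%:E = \int[mu]_x (G (x + c))%:E)%E.
  rewrite (@increasing_ge0_integration_by_substitutionT _ (fun x => x + c) G)//.
  - by apply: eq_integral => x _; rewrite d1 /= fctE mulr1.
  - by move=> x y xy; rewrite ltrD2r.
  - by rewrite d1; exact: cst_continuous.
  - by rewrite d1; exact: is_cvg_cst.
  - by rewrite d1; exact: is_cvg_cst.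
  - apply/cvgrNyPle => A; near=> x; rewrite -lerBrDr; near: x.
    by apply: nbhs_ninfty_le; exact: num_real.
  - apply/cvgryPge => A; near=> x; rewrite -lerBlDr; near: x.
    by apply: nbhs_pinfty_ge; exact: num_real.
have mGc : measurable_fun setT (EFin \o (fun x => G (x + c))).
  by apply/measurable_EFinP; exact: continuous_measurable_fun.
split => //; last by rewrite -rE /Rintegral E.
apply/integrableP; split => //=.
under eq_integral do rewrite ger0_norm//.
rewrite -E -ge0_fin_numE ?integral_ge0//; last by move=> x _; rewrite lee_fin.
exact: integrable_fin_num.
Unshelve. all: by end_near. Qed.

(** By evenness it suffices to integrate over the half-line, where [- d^-1 * expR (- (d * x))] is a
    primitive vanishing at infinity. *)
Lemma integrable_expR_normN d : 0 < d ->
  mu.-integrable setT (EFin \o (fun x => expR (- (d * `|x|)))).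
Proof.
move=> d0.
have cE : continuous (fun x : R => expR (- (d * x))).
  move=> x; apply: continuous_comp; last exact: continuous_expR.
  by apply: continuousN; apply: continuousM => //; exact: cst_continuous.
have cf : continuous (fun x : R => expR (- (d * `|x|))).
  move=> x; apply: (@continuous_comp R R R (fun y : R => `|y|) (fun x : R => expR (- (d * x)))).
    exact: norm_continuous.
  exact: cE.
apply/integrableP; split.
  by apply/measurable_EFinP; exact: continuous_measurable_fun.
under eq_integral do rewrite /= ger0_norm ?expR_ge0//.
rewrite (ge0_symfun_integralT (fun x => expR_ge0 _) cf); last first.
  by move=> x /=; rewrite normrN.
apply: lte_mul_pinfty => //.
rewrite -set_itvcy.
rewrite (@eq_integral _ _ _ mu _ (fun x => (expR (- (d * x)))%:E)); last first.
  by move=> x; rewrite inE /= in_itv /= andbT => x0; rewrite ger0_norm.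
have dF (x : R) : is_derive x 1 (fun x : R => - d^-1 * expR (- (d * x))) (expR (- (d * x))).
  apply: is_derive_eq.
  by rewrite /GRing.scale /=; field; lra.
rewrite (@ge0_continuous_FTC2y _ _ (fun x => - d^-1 * expR (- (d * x))) _ 0)//.
- by rewrite -EFinB ltry.
- exact: continuous_subspaceT.
- rewrite -[X in _ --> X](mulr0 (- d^-1)); apply: cvgM; first exact: cvg_cst.
  apply: (@cvg_comp _ _ _ (fun x => d * x) (fun x => expR (- x)) _
    (pinfty_nbhs R)); last exact: cvgr_expR.
  exact: gt0_cvgMry.
- apply: cvg_at_right_filter; apply: cvgM; first exact: cvg_cst.
  exact: cE.
- by move=> x _; rewrite derive1E derive_val.
Qed.

Lemma has_int_dominated G M d : 0 < d -> continuous G ->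
  (forall x, 0 <= G x <= M * expR (- (d * `|x|))) -> has_int G (\int[mu]_x G x).
Proof.
move=> d0 cG hG; split => //.
have iE := integrableZl measurableT M (integrable_expR_normN d0).
apply: (le_integrable measurableT _ _ iE).
  by apply/measurable_EFinP; exact: continuous_measurable_fun.
move=> x _ /=; have /andP[G0 GM] := hG x; rewrite lee_fin ger0_norm//.
by rewrite (le_trans GM)// ler_norm.
Qed.

End Integral.

(** * Powers as Mellin integrals *)

Section Mellin.
Context {R : realType}.
Implicit Types (f g phi : R -> R) (al r c : R).

(* The integral of g(u) u^(-al-1) over u > 0 equals r, written with u = e^v. *)
Definition mellin al g r := has_int (fun v => g (expR v) * expR (- (al * v))) r.

Lemma mellin_ext al f g r : (forall u, 0 < u -> f u = g u) ->
  mellin al f r -> mellin al g r.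
Proof. by move=> fg; apply: has_int_ext => v; rewrite fg ?expR_gt0. Qed.

Lemma mellinD al f g r c : mellin al f r -> mellin al g c ->
  mellin al (fun u => f u + g u) (r + c).
Proof.
by move=> hf hg; apply: has_int_ext (has_intD hf hg) => v; rewrite mulrDl.
Qed.

Lemma mellinZ al f r c : mellin al f r -> mellin al (fun u => c * f u) (c * r).
Proof. by move=> hf; apply: has_int_ext (has_intZ c hf) => v; rewrite mulrA. Qed.

Lemma mellinB al f g r c : mellin al f r -> mellin al g c ->
  mellin al (fun u => f u - g u) (r - c).
Proof.
move=> hf hg; rewrite -mulN1r.
by apply: mellin_ext (mellinD hf (mellinZ (-1) hg)) => u _; rewrite mulN1r.
Qed.

Lemma mellin_sum al (I : finType) (f : I -> R -> R) (r : I -> R) :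
  (forall i, mellin al (f i) (r i)) ->
  mellin al (fun u => \sum_i f i u) (\sum_i r i).
Proof.
move=> h; have := has_int_sum (index_enum I) h.
by apply: has_int_ext => v; rewrite mulr_suml.
Qed.

Lemma mellin_ge0 al g r : mellin al g r -> (forall u, 0 < u -> 0 <= g u) -> 0 <= r.
Proof.
by move=> /has_int_ge0 h g0; apply: h => v; rewrite mulr_ge0 ?g0 ?expR_gt0 ?expR_ge0.
Qed.

Lemma mellin_gt0 al g r : mellin al g r -> (forall u, 0 < u -> 0 <= g u) ->
  (exists2 u, 0 < u & 0 < g u) -> 0 < r.
Proof.
move=> /has_int_gt0 h g0 [u u0 gu]; apply: h => [v|].
  by rewrite mulr_ge0 ?g0 ?expR_gt0 ?expR_ge0.
by exists (ln u); rewrite lnK ?posrE// mulr_gt0 ?expR_gt0.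
Qed.

(* The dilation u |-> x u is a translation of v = ln u, and it pulls the factor
   x^al out of the integral. *)
Lemma mellin_powR phi al (p q : nat) (M : R) :
  continuous phi -> phi 0 = 0 -> q%:R < al < p%:R -> 0 < phi 1 ->
  (forall u, 0 <= u -> 0 <= phi u) ->
  (forall u, 0 <= u -> phi u <= M * u ^+ p) ->
  (forall u, 0 <= u -> phi u <= M * u ^+ q) ->
  exists2 C, 0 < C & forall x, 0 <= x -> mellin al (fun u => phi (x * u)) (C * x `^ al).
Proof.
move=> cphi phi0 /andP[qal alp] phi1 phi_ge0 phip phiq.
have M0 : 0 < M by apply: (lt_le_trans phi1); rewrite (le_trans (phip _ _))// expr1n mulr1.
pose psi v := phi (expR v) * expR (- (al * v)).
have psi_ge0 v : 0 <= psi v by rewrite mulr_ge0 ?phi_ge0 ?expR_ge0.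
have cpsi : continuous psi.
  move=> v; apply: (@continuousM R R (fun v => phi (expR v)) (fun v => expR (- (al * v)))).
    by apply: continuous_comp; [exact: continuous_expR|exact: cphi].
  apply: continuous_comp; last exact: continuous_expR.
  by apply: continuousN; apply: continuousM => //; exact: cst_continuous.
(* For v >= 0 the bound by u^q leaves the decay rate al - q, for v < 0 the bound by u^p leaves p -
   al; the smaller rate serves both. *)
pose d := Num.min (p%:R - al) (al - q%:R).
have [dp dq] : d <= p%:R - al /\ d <= al - q%:R.
  by split; rewrite ge_min lexx ?orbT.
have d0 : 0 < d by rewrite lt_min !subr_gt0 qal alp.
have psiM v : 0 <= psi v <= M * expR (- (d * `|v|)).
  rewrite psi_ge0 /=; have [v0|v0] := leP 0 v.
  - apply: (@le_trans _ _ (M * expR v ^+ q * expR (- (al * v)))).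
      by rewrite ler_wpM2r ?expR_ge0 ?phiq ?expR_ge0.
    rewrite -mulrA (ler_wpM2l (ltW M0))// -expRM_natl -expRD ler_expR ger0_norm//; nra.
  - apply: (@le_trans _ _ (M * expR v ^+ p * expR (- (al * v)))).
      by rewrite ler_wpM2r ?expR_ge0 ?phip ?expR_ge0.
    rewrite -mulrA (ler_wpM2l (ltW M0))// -expRM_natl -expRD ler_expR ltr0_norm//; nra.
have Ipsi := has_int_dominated d0 cpsi psiM.
set C := (X in has_int _ X) in Ipsi.
exists C.
  apply: (has_int_gt0 Ipsi) => //; exists 0.
  by rewrite /psi expR0 mulr0 oppr0 expR0 mulr1.
(* Translation by ln x requires x > 0. At x = 0 both sides vanish, since al > q >= 0 makes 0^al
   equal to 0. *)
move=> x; rewrite le_eqVlt => /predU1P[<-|x0].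
  have al0 : al != 0 by rewrite gt_eqF// (le_lt_trans _ qal).
  by rewrite powR0// mulr0; apply: has_int_ext has_int0 => v; rewrite mul0r phi0 mul0r.
rewrite mulrC; apply: has_int_ext (has_intZ _ (has_int_translate (ln x) psi_ge0 Ipsi)) => v.
rewrite /psi /powR gt_eqF// expRD lnK ?posrE// [expR v * x]mulrC mulrCA -expRD.
by congr (_ * expR _); ring.
Qed.

(** * Integral representations of powers in three ranges of the exponent *)

Lemma sin_le_id (x : R) : 0 <= x -> sin x <= x.
Proof.
rewrite le_eqVlt => /predU1P[<-|x0]; first by rewrite sin0.
have [c _] := MVT x0 (fun y _ => is_derive_sin y)
  (continuous_subspaceT (@continuous_sin R)).
rewrite sin0 !subr0 => ->; have := cos_le1 c; nra.
Qed.

Lemma one_sub_cos_le (x : R) : 0 <= x -> 1 - cos x <= x ^+ 2.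
Proof.
rewrite le_eqVlt => /predU1P[<-|x0]; first by rewrite cos0 subrr expr0n.
have [c] := MVT x0 (fun y _ => is_derive_cos y)
  (continuous_subspaceT (@continuous_cos R)).
rewrite in_itv /= => /andP[c0 cx]; rewrite cos0 !subr0 => h.
have := sin_le_id (ltW c0); nra.
Qed.

(** A first-order zero at 0 and boundedness at infinity give [p] = 1 and [q] = 0. *)
Lemma mellin_one_sub_exp al : 0 < al < 1 ->
  exists2 C, 0 < C & forall x, 0 <= x ->
    mellin al (fun u => 1 - expR (- (x * u))) (C * x `^ al).
Proof.
move=> al01; have E1 (u : R) : 0 <= u -> expR (- u) <= 1.
  by move=> u0; rewrite expR_le1 oppr_le0.
apply: (@mellin_powR (fun u => 1 - expR (- u)) al 1 0 1) => //.
- move=> u; apply: cvgB; first exact: cvg_cst.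
  by apply: continuous_comp; [exact: continuousN|exact: continuous_expR].
- by rewrite oppr0 expR0 subrr.
- by move=> u /E1 /=; lra.
- by move=> u u0 /=; have := expR_ge1Dx (- u); rewrite expr1; lra.
- by move=> u u0 /=; have := expR_ge0 (- u); rewrite expr0; lra.
Qed.

(** Removing the affine part of the exponential yields a second-order zero at 0 at the price of
    linear growth: [p] = 2 and [q] = 1. *)
Lemma mellin_exp_sub_affine al : 1 < al < 2 ->
  exists2 C, 0 < C & forall x, 0 <= x ->
    mellin al (fun u => expR (- (x * u)) - 1 + x * u) (C * x `^ al).
Proof.
move=> al12.
apply: (@mellin_powR (fun u => expR (- u) - 1 + u) al 2 1 1) => //.
- move=> u; apply: cvgD => //; apply: cvgB; last exact: cvg_cst.
  by apply: continuous_comp; [exact: continuousN|exact: continuous_expR].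
- by rewrite oppr0 expR0 subrr addr0.
- by move=> u u0 /=; have := expR_ge1Dx (- u); lra.
- move=> u u0 /=; have := expR_ge1Dx u; have := expRxMexpNx_1 u.
  have := expR_gt0 (- u); set E := expR (- u); set F := expR u => E0 FE F1.
  have h : E * (1 + u) <= 1 by nra.
  (* After multiplication by 1 + u the claim reads E (1 + u) <= 1 + u^3, and [h] bounds the left
     side by 1. *)
  suff : 0 <= (1 - u + u ^+ 2 - E) * (1 + u) by rewrite pmulr_lge0; lra.
  by nra.
- by move=> u u0 /=; have : expR (- u) <= 1; [rewrite expR_le1; lra|rewrite expr1; lra].
Qed.

Lemma mellin_one_sub_cos al : 0 < al < 2 ->
  exists2 C, 0 < C & forall x, 0 <= x ->
    mellin al (fun u => 1 - cos (x * u)) (C * x `^ al).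
Proof.
move=> al02; apply: (@mellin_powR (fun u => 1 - cos u) al 2 0 2) => //.
- move=> u; apply: cvgB; first exact: cvg_cst.
  exact: continuous_cos.
- by rewrite cos0 subrr.
- rewrite /= subr_gt0 -[ltRHS](@cos0 R) ltr_cos// in_itv /= ?lexx ?pi_ge0//.
  by have := pi_ge2 R; lra.
- by move=> u u0 /=; have := one_sub_cos_le u0; have := sqr_ge0 u; lra.
- by move=> u u0 /=; have := cos_geN1 u; rewrite expr0; lra.
Qed.

End Mellin.

(** * Positive definite kernels and the Schur product *)

Section QuadraticForms.
Context {R : realType} {I : finType}.
Implicit Types (k P : I -> I -> R) (a b : I -> R) (c : R).

(** Kernels on a finite type replace matrices, so that entrywise operations are plain function
    expressions; [quad_mx] translates back. *)
Definition quad k a := \sum_i \sum_j a i * a j * k i j.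
Definition psd k := forall a, 0 <= quad k a.
Definition pd k := forall a, (exists i, a i != 0) -> 0 < quad k a.

Lemma kernel_ext k k' : (forall i j, k i j = k' i j) -> k = k'.
Proof. by move=> kk'; apply/funext => i; apply/funext => j. Qed.

Lemma pd_ext k k' : (forall i j, k i j = k' i j) -> pd k -> pd k'.
Proof. by move=> /kernel_ext <-. Qed.

Lemma quadD k k' a : quad (fun i j => k i j + k' i j) a = quad k a + quad k' a.
Proof.
rewrite /quad -big_split; apply: eq_bigr => i _; rewrite -big_split.
by apply: eq_bigr => j _; rewrite mulrDr.
Qed.

Lemma quadZ c k a : quad (fun i j => c * k i j) a = c * quad k a.
Proof.
rewrite /quad mulr_sumr; apply: eq_bigr => i _; rewrite mulr_sumr.
by apply: eq_bigr => j _; rewrite mulrCA.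
Qed.

Lemma quad_scale k a b :
  quad (fun i j => b i * b j * k i j) a = quad k (fun i => a i * b i).
Proof. by apply: eq_bigr => i _; apply: eq_bigr => j _; ring. Qed.

Lemma quad_rank1 a b : quad (fun i j => b i * b j) a = (\sum_i a i * b i) ^+ 2.
Proof.
rewrite expr2 mulr_suml; apply: eq_bigr => i _; rewrite mulr_sumr.
by apply: eq_bigr => j _; ring.
Qed.

Lemma pd_psd k : pd k -> psd k.
Proof.
move=> kpd a; have [/kpd/ltW//|a0] := pselect (exists i, a i != 0).
rewrite /quad big1// => i _; rewrite big1// => j _.
have [->|ai] := eqVneq (a i) 0; first by rewrite !mul0r.
by exfalso; apply: a0; exists i.
Qed.

Lemma psdD k k' : psd k -> psd k' -> psd (fun i j => k i j + k' i j).
Proof. by move=> h h' a; rewrite quadD addr_ge0. Qed.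

Lemma pdDl k k' : pd k -> psd k' -> pd (fun i j => k i j + k' i j).
Proof. by move=> h h' a /h a0; rewrite quadD ltr_wpDr. Qed.

Lemma pdD k k' : pd k -> pd k' -> pd (fun i j => k i j + k' i j).
Proof. by move=> h /pd_psd; exact: pdDl. Qed.

Lemma psdZ c k : 0 <= c -> psd k -> psd (fun i j => c * k i j).
Proof. by move=> c0 h a; rewrite quadZ mulr_ge0. Qed.

Lemma pdZ c k : 0 < c -> pd k -> pd (fun i j => c * k i j).
Proof. by move=> c0 h a /h a0; rewrite quadZ mulr_gt0. Qed.

Lemma pdZV c k : 0 < c -> pd (fun i j => c * k i j) -> pd k.
Proof.
move=> c0 /(@pdZ c^-1) h; apply: pd_ext (h _) => [i j|].
  by rewrite mulKf// gt_eqF.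
by rewrite invr_gt0.
Qed.

Lemma pd_scale k b : (forall i, b i != 0) -> pd k -> pd (fun i j => b i * b j * k i j).
Proof.
move=> b0 h a [i ai]; rewrite quad_scale; apply: h; exists i.
by rewrite mulf_neq0.
Qed.

(** A quadratic form is a finite linear combination of the entries, so an entrywise integral
    representation passes to the form, and positivity can be checked for each u. *)
Lemma mellin_quad al (g : R -> I -> I -> R) k a :
  (forall i j, mellin al (fun u => g u i j) (k i j)) ->
  mellin al (fun u => quad (g u) a) (quad k a).
Proof.
move=> h; apply: mellin_sum => i; apply: mellin_sum => j; exact: mellinZ.
Qed.

Lemma mellin_psd al (g : R -> I -> I -> R) k :
  (forall i j, mellin al (fun u => g u i j) (k i j)) ->
  (forall u, 0 < u -> psd (g u)) -> psd k.
Proof.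
by move=> h g0 a; apply: (mellin_ge0 (mellin_quad a h)) => u u0; exact: g0.
Qed.

Lemma mellin_pd al (g : R -> I -> I -> R) k :
  (forall i j, mellin al (fun u => g u i j) (k i j)) ->
  (forall u, 0 < u -> pd (g u)) -> pd k.
Proof.
move=> h g0 a a0; apply: (mellin_gt0 (mellin_quad a h)) => [u u0|].
  exact/pd_psd/g0.
by exists 1 => //; exact: g0.
Qed.

(** Being a multiplier of the positive semidefinite cone is the conclusion of Schur's product
    theorem. It is immediate for mixtures of Gram kernels and stable under sums and nonnegative
    multiples, so no matrix has to be factored. *)
Definition schur k := forall P, psd P -> psd (fun i j => P i j * k i j).

Lemma schurD k k' : schur k -> schur k' -> schur (fun i j => k i j + k' i j).
Proof.
move=> h h' P P0 a; rewrite [X in quad X](_ : _ = fun i j => P i j * k i j + P i j * k' i j).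
  by apply: psdD; [exact: h|exact: h'].
by apply/kernel_ext => i j; rewrite mulrDr.
Qed.

Lemma schurZ c k : 0 <= c -> schur k -> schur (fun i j => c * k i j).
Proof.
move=> c0 h P P0 a; rewrite [X in quad X](_ : _ = fun i j => c * (P i j * k i j)).
  by apply: psdZ => //; exact: h.
by apply/kernel_ext => i j; rewrite mulrCA.
Qed.

(** For each u the integrand of the form at [a] is the form of [P] at the vector a_i f_i(u), hence
    nonnegative. *)
Lemma gram_schur al (f : I -> R -> R) k :
  (forall i j, mellin al (fun u => f i u * f j u) (k i j)) -> schur k.
Proof.
move=> h P P0; apply: (@mellin_psd al (fun u i j => f i u * f j u * P i j)).
  by move=> i j; apply: mellin_ext (mellinZ (P i j) (h i j)) => u _; rewrite mulrC.
by move=> u _ a; rewrite quad_scale.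
Qed.

(** The integrand of the form is the square of the sum of a_i f_i(u). If it were positive at no u >
    0, that sum would vanish identically and independence would give a = 0. *)
Lemma gram_pd al (f : I -> R -> R) k :
  (forall i j, mellin al (fun u => f i u * f j u) (k i j)) ->
  (forall a, (forall u, 0 < u -> \sum_i a i * f i u = 0) -> forall i, a i = 0) ->
  pd k.
Proof.
move=> h indep a [i ai]; apply: (mellin_gt0 (mellin_quad a h)) => [u _|].
  by rewrite quad_rank1 sqr_ge0.
apply/not_exists2P => H; move/eqP: ai; apply; apply: indep => u u0.
have [//|/negP] := H u; rewrite quad_rank1 lt0r sqr_ge0 andbT negbK => /eqP.
by move/eqP; rewrite sqrf_eq0 => /eqP.
Qed.

(** Induction from the all-ones kernel, which has rank one; [schur k] absorbs each further
    factor. *)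
Lemma psd_expr k n : schur k -> psd (fun i j => k i j ^+ n).
Proof.
move=> h; elim: n => [|n ih].
  move=> a; rewrite [X in quad X](_ : _ = fun i j => 1 * 1).
    by rewrite (quad_rank1 a (fun=> 1)) sqr_ge0.
  by apply/kernel_ext => i j; rewrite mulr1.
move=> a; have := h _ ih a; congr (0 <= quad _ a).
by apply/kernel_ext => i j; rewrite exprSr.
Qed.

Lemma cvg_sumr (f : I -> nat -> R) (l : I -> R) :
  (forall i, f i n @[n --> \oo] --> l i) ->
  \sum_i f i n @[n --> \oo] --> \sum_i l i.
Proof.
move=> fl; elim: (index_enum I) => [|i s ih].
  by rewrite big_nil; under eq_fun do rewrite big_nil; exact: cvg_cst.
by rewrite big_cons; under eq_fun do rewrite big_cons; exact: cvgD.
Qed.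

(* By Schur's product theorem all terms of the series of exp(k) - 1 are positive
   semidefinite, and the first one is k. *)
Lemma pd_expRB1 k : schur k -> pd k -> pd (fun i j => expR (k i j) - 1).
Proof.
move=> sk kpd a a0; apply: (lt_le_trans (kpd a a0)).
pose S n := quad (fun i j => series (exp_coeff (k i j)) n - 1) a.
have Scvg : S n @[n --> \oo] --> quad (fun i j => expR (k i j) - 1) a.
  apply: cvg_sumr => i; apply: cvg_sumr => j.
  apply: cvgM; first exact: cvg_cst.
  apply: cvgB; last exact: cvg_cst.
  exact: is_cvg_series_exp_coeff.
(* [series] at n sums the terms of index below n, so at n = 2 only 1 + k is present and subtracting
   1 leaves exactly k; every later term adds a nonnegative form. *)
suff S2 n : (2 <= n)%N -> quad k a <= S n.
  by apply: (cvgr_to_ge Scvg); near=> n; apply: S2; near: n; exact: nbhs_infty_ge.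
elim: n => // n ih; rewrite ltnS leq_eqVlt => /predU1P[<-|n1].
  rewrite le_eqVlt; apply/orP; left; apply/eqP; congr quad.
  apply/kernel_ext => i j; rewrite /series /= !big_nat_recl//= big_geq// /exp_coeff /=.
  by rewrite expr0 expr1 fact0 factS fact0 muln1; field.
apply: (le_trans (ih n1)); rewrite -subr_ge0.
have -> : S n.+1 - S n = (n`!%:R)^-1 * quad (fun i j => k i j ^+ n) a.
  rewrite -quadZ /S -[- quad _ _]mulN1r -quadZ -quadD; congr quad.
  by apply/kernel_ext => i j; rewrite /series /= big_nat_recr//= /exp_coeff /=; ring.
by rewrite mulr_ge0 ?invr_ge0// psd_expr.
Unshelve. all: by end_near. Qed.

End QuadraticForms.

(** * Linear independence of exponential and trigonometric functions *)

Section LinearIndependence.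
Context {R : realType} {I : finType}.
Implicit Types (a t lam : I -> R).

(* All sums of a_i p(lam_i) vanish; take p = prod_(j != i) (X - lam_j). *)
Lemma vandermonde_indep lam a : injective lam ->
  (forall n, \sum_i a i * lam i ^+ n = 0) -> forall i, a i = 0.
Proof.
move=> lam_inj h i.
have hp (p : {poly R}) : \sum_j a j * p.[lam j] = 0.
  under eq_bigr do rewrite horner_coef mulr_sumr.
  rewrite exchange_big big1// => n _ /=.
  transitivity (p`_n * \sum_j a j * lam j ^+ n); last by rewrite h mulr0.
  by rewrite mulr_sumr; apply: eq_bigr => j _; rewrite mulrCA.
have := hp (\prod_(j | j != i) ('X - (lam j)%:P)).
rewrite (bigD1 i)//= [X in _ + X]big1 ?addr0; last first.
  by move=> j ji; rewrite horner_prod (bigD1 j)//= hornerXsubC subrr mul0r mulr0.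
move/eqP; rewrite mulf_eq0 horner_prod => /orP[/eqP//|].
rewrite prodf_seq_eq0 => /hasP[j _ /andP[ji]].
by rewrite hornerXsubC subr_eq0 => /eqP/lam_inj ij; rewrite ij eqxx in ji.
Qed.

(** Sampling at natural u and subtracting consecutive relations removes the constants and leaves
    power sums of the distinct numbers lam_j = e^(-t_j) with coefficients a_j (1 - lam_j), where
    lam_j < 1. *)
Lemma one_sub_exp_indep t a : injective t -> (forall i, 0 < t i) ->
  (forall u, 0 < u -> \sum_i a i * (1 - expR (- (t i * u))) = 0) ->
  forall i, a i = 0.
Proof.
move=> t_inj t0 h i; pose lam j := expR (- t j).
have lam_inj : injective lam by move=> j l /expR_inj/oppr_inj/t_inj.
have hn n : \sum_j a j * (1 - lam j ^+ n) = 0.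
  case: n => [|n]; first by rewrite big1// => j _; rewrite expr0 subrr mulr0.
  rewrite -[RHS](h n.+1%:R (ltr0Sn R n)); apply: eq_bigr => j _.
  by rewrite -expRM_natr mulNr.
have H : forall n, \sum_j a j * (1 - lam j) * lam j ^+ n = 0.
  move=> n; transitivity (\sum_j a j * (1 - lam j ^+ n.+1) - \sum_j a j * (1 - lam j ^+ n)).
    rewrite -sumrB.
    by apply: eq_bigr => j _; rewrite exprS; ring.
  by rewrite !hn subrr.
have /eqP := vandermonde_indep lam_inj H i.
rewrite mulf_eq0 => /orP[/eqP//|].
rewrite subr_eq0 eq_sym /lam => /eqP; have := t0 i.
by rewrite -oppr_lt0 -expR_lt1 => /[swap] ->; rewrite ltxx.
Qed.

(* The functions u |-> cos (t_i u) are eigenfunctions of f |-> f(.+h) + f(.-h)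
   with eigenvalues 2 cos(t_i h), which are distinct for small h. *)
Lemma cos_indep t a : injective t -> (forall i, 0 < t i) ->
  (forall u, \sum_i a i * cos (t i * u) = 0) -> forall i, a i = 0.
Proof.
(* With this h every t_i h lies in [0, 1], inside the interval [0, pi] on which cosine is
   injective. *)
move=> t_inj t0 hf; pose h := (1 + \sum_i t i)^-1.
have s0 : 0 <= \sum_i t i by apply: sumr_ge0 => i _; exact: ltW.
have h0 : 0 < h by rewrite invr_gt0; lra.
have th i : t i * h \in `[0, pi].
  rewrite in_itv /= (mulr_ge0 (ltW (t0 i)) (ltW h0)) /=.
  apply: (@le_trans _ _ 1); last by have := pi_ge2 R; lra.
  rewrite ler_pdivrMr ?mul1r; last lra.
  rewrite (bigD1 i)//=; have : 0 <= \sum_(j | j != i) t j by apply: sumr_ge0 => j _; exact: ltW.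
  lra.
apply: (@vandermonde_indep (fun i => cos (t i * h))).
  move=> i j /(cos_inj (th i) (th j)) /mulIf E; apply/t_inj/E.
  by rewrite gt_eqF.
(* The relation is kept for all u because the induction evaluates it at u + h and u - h; u = 0 then
   gives the power sums. *)
suff H n u : \sum_i a i * cos (t i * h) ^+ n * cos (t i * u) = 0.
  move=> n; rewrite -[RHS](H n 0); apply: eq_bigr => i _.
  by rewrite mulr0 cos0 mulr1.
elim: n u => [|n ih] u.
  by rewrite -[RHS](hf u); apply: eq_bigr => i _; rewrite expr0 mulr1.
apply: (@mulfI _ 2); first by rewrite pnatr_eq0.
transitivity (\sum_i a i * cos (t i * h) ^+ n * cos (t i * (u + h)) +
    \sum_i a i * cos (t i * h) ^+ n * cos (t i * (u - h))); last by rewrite !ih; ring.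
rewrite -big_split mulr_sumr; apply: eq_bigr => i _ /=.
by rewrite (mulrDr (t i) u h) (mulrBr (t i) u h) cosD cosB exprS; ring.
Qed.

Lemma pihalf_div i t : 0 < t i -> t i * (pi / 2 / t i) = pi / 2.
Proof. by move=> t0; rewrite mulrC divfK// gt_eqF. Qed.

(** The difference sin(t(u + h)) - sin(t(u - h)) = 2 sin(th) cos(tu) reduces to cosines. With h = pi
    / (2 t_i) the i-th coefficient is a_i itself. *)
Lemma sin_indep t a : injective t -> (forall i, 0 < t i) ->
  (forall u, 0 < u -> \sum_i a i * sin (t i * u) = 0) -> forall i, a i = 0.
Proof.
move=> t_inj t0 hf i.
have hf' u : \sum_i a i * sin (t i * u) = 0.
  have [|u0|<-] := ltgtP 0 u; first exact: hf.
    apply: oppr_inj; rewrite oppr0 -[RHS](hf (- u)) ?oppr_gt0//.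
    by rewrite -sumrN; apply: eq_bigr => j _; rewrite mulrN sinN mulrN.
  by rewrite big1// => j _; rewrite mulr0 sin0 mulr0.
pose h := pi / 2 / t i.
have H : forall u, \sum_j a j * sin (t j * h) * cos (t j * u) = 0.
  move=> u; apply: (@mulfI _ 2); first by rewrite pnatr_eq0.
  transitivity (\sum_j a j * sin (t j * (u + h)) - \sum_j a j * sin (t j * (u - h)));
    last by rewrite !hf'; ring.
  rewrite -sumrB mulr_sumr; apply: eq_bigr => j _; rewrite mulrDr mulrBr sinD sinB; ring.
have := cos_indep t_inj t0 H i.
by rewrite pihalf_div// sin_pihalf mulr1.
Qed.

(** A second difference with step h kills the constant and turns 1 - cos(tu) into 2 (1 - cos(th))
    cos(tu); again h = pi / (2 t_i) makes the i-th coefficient a_i. *)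
Lemma one_sub_cos_indep t a : injective t -> (forall i, 0 < t i) ->
  (forall u, 0 < u -> \sum_i a i * (1 - cos (t i * u)) = 0) -> forall i, a i = 0.
Proof.
move=> t_inj t0 hf i.
have hf' u : \sum_i a i * (1 - cos (t i * u)) = 0.
  have [|u0|<-] := ltgtP 0 u; first exact: hf.
    rewrite -[RHS](hf (- u)) ?oppr_gt0//.
    by apply: eq_bigr => j _; rewrite mulrN cosN.
  by rewrite big1// => j _; rewrite mulr0 cos0 subrr mulr0.
pose h := pi / 2 / t i.
have H : forall u, \sum_j a j * (1 - cos (t j * h)) * cos (t j * u) = 0.
  move=> u; apply: (@mulfI _ 2); first by rewrite pnatr_eq0.
  transitivity (\sum_j a j * (1 - cos (t j * (u + h))) + \sum_j a j * (1 - cos (t j * (u - h)))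
     - 2 * \sum_j a j * (1 - cos (t j * u))); last by rewrite !hf'; ring.
  rewrite !mulr_sumr -big_split -sumrB /=.
  apply: eq_bigr => j _; rewrite (mulrDr (t j) u h) (mulrBr (t j) u h) cosD cosB; ring.
have := cos_indep t_inj t0 H i.
by rewrite pihalf_div// cos_pihalf subr0 mulr1.
Qed.

End LinearIndependence.

(** * Power kernels *)

Section Kernels.
Context {R : realType} {I : finType}.
Implicit Types (t x h : I -> R) (d : I -> I -> R) (al c : R).

Definition subadd al t i j := t i `^ al + t j `^ al - (t i + t j) `^ al.
(** Let B be a two-sided fractional Brownian motion with 2H = [al]. This is the covariance of B_t -
    B_(-t); [sub_fbm] is that of (B_t + B_(-t)) / sqrt 2, and [fbm] is twice that of B. *)
Definition odd_fbm al t i j := (t i + t j) `^ al - `|t i - t j| `^ al.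
Definition sub_fbm al t i j :=
  t i `^ al + t j `^ al - 2^-1 * ((t i + t j) `^ al + `|t i - t j| `^ al).
Definition fbm al t i j := t i `^ al + t j `^ al - `|t i - t j| `^ al.

Lemma expRNDM (x y u : R) :
  expR (- ((x + y) * u)) = expR (- (x * u)) * expR (- (y * u)).
Proof. by rewrite -expRD; congr expR; ring. Qed.

Lemma gram_pd_schur al c (f : I -> R -> R) (k : I -> I -> R) : 0 < c ->
  (forall i j, mellin al (fun u => f i u * f j u) (c * k i j)) ->
  (forall a, (forall u, 0 < u -> \sum_i a i * f i u = 0) -> forall i, a i = 0) ->
  pd k /\ schur k.
Proof.
move=> c0 h indep; split; first exact: pdZV c0 (gram_pd h indep).
have := schurZ (ltW (_ : 0 < c^-1)) (gram_schur h); rewrite invr_gt0 => /(_ c0).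
by congr schur; apply: kernel_ext => i j; rewrite mulKf// gt_eqF.
Qed.

Lemma subadd_pd_schur al t : 0 < al < 1 -> injective t -> (forall i, 0 < t i) ->
  pd (subadd al t) /\ schur (subadd al t).
Proof.
move=> al01 t_inj t0; have [C C0 H] := mellin_one_sub_exp al01.
apply: (@gram_pd_schur al C (fun i u => 1 - expR (- (t i * u)))) => //; last first.
  by move=> a; exact: one_sub_exp_indep.
move=> i j; have ti := ltW (t0 i); have tj := ltW (t0 j).
rewrite /subadd mulrBr mulrDr.
apply: mellin_ext (mellinB (mellinD (H _ ti) (H _ tj)) (H _ (addr_ge0 ti tj))) => u _.
by rewrite expRNDM; ring.
Qed.

(** The affine terms cancel in the combination, leaving the same product (1 - e^(-xu)) (1 - e^(-yu))
    as for exponents below 1. *)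
Lemma superadd_pd al t : 1 < al < 2 -> injective t -> (forall i, 0 < t i) ->
  pd (fun i j => (t i + t j) `^ al - t i `^ al - t j `^ al).
Proof.
move=> al12 t_inj t0; have [C C0 H] := mellin_exp_sub_affine al12.
have [] // := @gram_pd_schur al C (fun i u => 1 - expR (- (t i * u)))
  (fun i j => (t i + t j) `^ al - t i `^ al - t j `^ al) C0.
  move=> i j; have ti := ltW (t0 i); have tj := ltW (t0 j).
  rewrite !mulrBr.
  apply: mellin_ext (mellinB (mellinB (H _ (addr_ge0 ti tj)) (H _ ti)) (H _ tj)) => u _.
  by rewrite expRNDM; ring.
by move=> a; exact: one_sub_exp_indep.
Qed.

Lemma cos_normM (x u : R) : 0 < u -> cos (`|x| * u) = cos (x * u).
Proof. by move=> u0; rewrite -[RHS]cos_norm normrM (gtr0_norm u0). Qed.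

(** Since cos(x - y) - cos(x + y) = 2 sin x sin y, the Gram functions are sines and the normalising
    constant is halved. *)
Lemma odd_fbm_pd_schur al t : 0 < al < 2 -> injective t -> (forall i, 0 < t i) ->
  pd (odd_fbm al t) /\ schur (odd_fbm al t).
Proof.
move=> al02 t_inj t0; have [C C0 H] := mellin_one_sub_cos al02.
apply: (@gram_pd_schur al (2^-1 * C) (fun i u => sin (t i * u))); first lra.
  move=> i j; have ti := ltW (t0 i); have tj := ltW (t0 j).
  rewrite /odd_fbm -mulrA mulrBr.
  apply: mellin_ext (mellinZ _ (mellinB (H _ (addr_ge0 ti tj)) (H _ (normr_ge0 _)))) => u u0.
  by rewrite cos_normM// (mulrDl (t i)) (mulrBl u) cosD cosB; field.
by move=> a; exact: sin_indep.
Qed.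

Lemma sub_fbm_pd_schur al t : 0 < al < 2 -> injective t -> (forall i, 0 < t i) ->
  pd (sub_fbm al t) /\ schur (sub_fbm al t).
Proof.
move=> al02 t_inj t0; have [C C0 H] := mellin_one_sub_cos al02.
apply: (@gram_pd_schur al C (fun i u => 1 - cos (t i * u))) => //.
  move=> i j; have ti := ltW (t0 i); have tj := ltW (t0 j).
  rewrite /sub_fbm mulrBr mulrDr mulrCA mulrDr.
  apply: mellin_ext (mellinB (mellinD (H _ ti) (H _ tj))
    (mellinZ _ (mellinD (H _ (addr_ge0 ti tj)) (H _ (normr_ge0 _))))) => u u0.
  by rewrite cos_normM// (mulrDl (t i)) (mulrBl u) cosD cosB; field.
by move=> a; exact: one_sub_cos_indep.
Qed.

(** Splitting into odd and even parts writes the kernel as half of [odd_fbm] plus [sub_fbm]. *)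
Lemma fbm_pd_schur al t : 0 < al < 2 -> injective t -> (forall i, 0 < t i) ->
  pd (fbm al t) /\ schur (fbm al t).
Proof.
move=> al02 t_inj t0.
have [p1 s1] := odd_fbm_pd_schur al02 t_inj t0.
have [p2 s2] := sub_fbm_pd_schur al02 t_inj t0.
rewrite (_ : fbm al t = fun i j => 2^-1 * odd_fbm al t i j + sub_fbm al t i j).
  split; first by apply: pdD => //; apply: pdZ.
  by apply: schurD => //; apply: schurZ.
by apply: kernel_ext => i j; rewrite /fbm /odd_fbm /sub_fbm; field.
Qed.

(* min(x, y) = (x + y - |x - y|) / 2 is the fractional Brownian kernel with H = 1/2. *)
Lemma min_pd h : injective h -> (forall i, 0 < h i) ->
  pd (fun i j => Num.min (h i) (h j)).
Proof.
move=> h_inj h0; have al1 : 0 < (1 : R) < 2 by lra.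
have [/(@pdZ _ _ 2^-1) p _] := fbm_pd_schur al1 h_inj h0.
apply: pd_ext (p _) => [i j|]; last by rewrite invr_gt0.
rewrite /fbm !powRr1 ?(ltW (h0 _))//.
by have [hij|hij] := leP (h i) (h j); [rewrite ler0_norm|rewrite gtr0_norm];
  rewrite ?subr_le0 ?subr_gt0//; field.
Qed.

(** For s <= t the integrand is e^(-tu) - e^(-(s + t)u) = e^(-su) e^(-tu) (e^(su) - 1): a rank-one
    factor times the minimum of an increasing function. *)
Lemma add_max_pd al t : 0 < al < 1 -> injective t -> (forall i, 0 < t i) ->
  pd (fun i j => (t i + t j) `^ al - Num.max (t i) (t j) `^ al).
Proof.
move=> al01 t_inj t0; have [C C0 H] := mellin_one_sub_exp al01.
apply: (pdZV C0).
apply: (@mellin_pd _ _ al (fun u i j => (1 - expR (- ((t i + t j) * u))) -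
   (1 - expR (- (Num.max (t i) (t j) * u))))) => [i j|u u0].
  have ti := ltW (t0 i); have tj := ltW (t0 j).
  by rewrite mulrBr; apply: mellinB; apply: H; rewrite ?addr_ge0// le_max ti.
pose h i := expR (t i * u) - 1.
have h_inj : injective h.
  by move=> i j /addIr/expR_inj/mulIf E; apply/t_inj/E; rewrite gt_eqF.
have h0 i : 0 < h i by rewrite subr_gt0 expR_gt1 mulr_gt0.
have e0 i : expR (- (t i * u)) != 0 by rewrite gt_eqF// expR_gt0.
apply: pd_ext (pd_scale e0 (min_pd h_inj h0)) => i j.
have hmono k l : t k <= t l -> h k <= h l.
  by move=> kl; rewrite lerD2r ler_expR ler_pM2r.
have Ei := expRxMexpNx_1 (t i * u); have Ej := expRxMexpNx_1 (t j * u).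
rewrite expRNDM /=.
have [tij|/ltW tij] := leP (t i) (t j).
  rewrite (min_idPl (hmono _ _ tij)) /h; ring: Ei.
rewrite (min_idPr (hmono _ _ tij)) /h; ring: Ej.
Qed.

(** For s <= t the integrand is e^(-(t - s)u) - e^(-tu) = e^(-su) e^(-tu) h(s) with h(s) = e^(su)
    (e^(su) - 1), which is increasing in s > 0. *)
Lemma max_dist_pd al t : 0 < al < 1 -> injective t -> (forall i, 0 < t i) ->
  pd (fun i j => Num.max (t i) (t j) `^ al - `|t i - t j| `^ al).
Proof.
move=> al01 t_inj t0; have [C C0 H] := mellin_one_sub_exp al01.
apply: (pdZV C0).
apply: (@mellin_pd _ _ al (fun u i j => (1 - expR (- (Num.max (t i) (t j) * u))) -
   (1 - expR (- (`|t i - t j| * u))))) => [i j|u u0].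
  by rewrite mulrBr; apply: mellinB; apply: H => //; rewrite le_max (ltW (t0 i)).
pose h i := expR (t i * u) * (expR (t i * u) - 1).
have e1 i : 1 < expR (t i * u) by rewrite expR_gt1 mulr_gt0.
have hmono k l : t k < t l -> h k < h l.
  move=> kl; have := e1 k; have := e1 l.
  have : expR (t k * u) < expR (t l * u) by rewrite ltr_expR ltr_pM2r.
  by rewrite /h; nra.
have h_inj : injective h.
  move=> i j hij; apply: t_inj; have [/hmono|/hmono|//] := ltgtP (t i) (t j).
    by rewrite hij ltxx.
  by rewrite hij ltxx.
have h0 i : 0 < h i by have := e1 i; rewrite /h; nra.
have e0 i : expR (- (t i * u)) != 0 by rewrite gt_eqF// expR_gt0.
apply: pd_ext (pd_scale e0 (min_pd h_inj h0)) => i j.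
have Ei := expRxMexpNx_1 (t i * u); have Ej := expRxMexpNx_1 (t j * u).
have [tij|tij|tij] := ltgtP (t i) (t j).
- rewrite (min_idPl (ltW (hmono _ _ tij))) /h ltr0_norm ?subr_lt0//.
  have -> : - (- (t i - t j) * u) = t i * u + - (t j * u) by ring.
  rewrite expRD; ring: Ei.
- rewrite (min_idPr (ltW (hmono _ _ tij))) /h gtr0_norm ?subr_gt0//.
  have -> : - ((t i - t j) * u) = - (t i * u) + t j * u by ring.
  rewrite expRD; ring: Ej.
- rewrite -(t_inj _ _ tij) minxx subrr normr0 mul0r oppr0 expR0 /h; ring: Ei.
Qed.

(** With k = x_i + x_j - d_ij, the integrand e^(-du) - e^(-(x_i + x_j)u) equals e^(-x_i u) e^(-x_j
    u) (e^(uk) - 1), so [pd_expRB1] applies. *)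
Lemma powR_comp_pd al x d : 0 < al < 1 -> (forall i, 0 <= x i) ->
  (forall i j, 0 <= d i j) ->
  pd (fun i j => x i + x j - d i j) -> schur (fun i j => x i + x j - d i j) ->
  pd (fun i j => (x i + x j) `^ al - d i j `^ al).
Proof.
move=> al01 x0 d0 kpd ks; have [C C0 H] := mellin_one_sub_exp al01.
apply: (pdZV C0).
apply: (@mellin_pd _ _ al (fun u i j => (1 - expR (- ((x i + x j) * u))) -
   (1 - expR (- (d i j * u))))) => [i j|u u0].
  by rewrite mulrBr; apply: mellinB; apply: H => //; exact: addr_ge0.
have e0 i : expR (- (x i * u)) != 0 by rewrite gt_eqF// expR_gt0.
apply: pd_ext (pd_scale e0 (pd_expRB1 (schurZ (ltW u0) ks) (pdZ u0 kpd))) => i j.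
rewrite mulrBr mulr1 expRNDM -!expRD.
have -> : - (x i * u) + - (x j * u) + u * (x i + x j - d i j) = - (d i j * u) by ring.
ring.
Qed.

End Kernels.

(** * The Gamma function on (0, 1) *)

Section Gamma.
Context {R : realType}.
Let mu := @lebesgue_measure R.
Implicit Types a z : R.

(** Staying away from 0 makes x^z / z a primitive up to the endpoints; the bound is uniform in [a],
    which permits the limit a -> 0. *)
Lemma integral_powR_itv a z : 0 < a < 1 -> 0 < z ->
  (\int[mu]_(x in `[a, 1%R]) (x `^ (z - 1))%:E <= (z^-1)%:E)%E.
Proof.
move=> /andP[a0 a1] z0.
have dP (y x : R) : 0 < x -> derivable (fun x : R => x `^ y) x 1.
  by move=> x0; apply: derivable_powR; rewrite in_itv /= x0.
have cP (y x : R) : 0 < x -> {for x, continuous (fun x : R => x `^ y)}.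
  by move=> x0; exact/differentiable_continuous/derivable1_diffP/dP.
have cF (x : R) : 0 < x -> {for x, continuous (fun x : R => z^-1 * x `^ z)}.
  by move=> x0; apply: cvgM; [exact: cvg_cst|exact: cP].
rewrite (@continuous_FTC2 _ _ (fun x : R => z^-1 * x `^ z))//.
- rewrite -EFinB lee_fin powR1 mulr1 gerBl mulr_ge0 ?powR_ge0// invr_ge0 ltW//.
- apply: derivable_within_continuous => x; rewrite in_itv /= => /andP[ax _].
  exact/dP/(lt_le_trans a0).
- split.
  + move=> x; rewrite in_itv /= => /andP[ax _].
    apply: derivableM; [exact: derivable_cst|exact/dP/(lt_trans a0)].
  + by apply: cvg_at_right_filter; exact: cF.
  + by apply: cvg_at_left_filter; exact: cF.
- move=> x; rewrite in_itv /= => /andP[ax _]; have x0 := lt_trans a0 ax.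
  rewrite derive1Ml; last exact: dP.
  rewrite powR_derive1 ?in_itv /= ?x0// mulrA mulVf ?mul1r//.
  by rewrite gt_eqF.
Qed.

Lemma integral_powR_itv0 z : 0 < z ->
  (\int[mu]_(x in `]0%R, 1%R]) (x `^ (z - 1))%:E <= (z^-1)%:E)%E.
Proof.
(* The shift to n + 2 keeps the left endpoint strictly below 1 already at n = 0. *)
move=> z0; pose F (n : nat) : set R := `[(n.+2%:R^-1)%R, 1%R]%classic.
have UF : `]0%R, 1%R]%classic = \bigcup_n F n.
  apply/seteqP; split=> x /=; rewrite in_itv /=.
    move=> /andP[x0 x1]; exists (Num.bound x^-1) => //; rewrite /F /= in_itv /= x1 andbT.
    rewrite -[leRHS]invrK lef_pV2 ?posrE ?invr_gt0//.
    apply/ltW/(lt_le_trans (archi_boundP _)); first by rewrite invr_ge0 ltW.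
    by rewrite ler_nat -addn2 leq_addr.
  move=> [n _]; rewrite /F /= in_itv /= => /andP[nx ->]; rewrite andbT.
  by rewrite (lt_le_trans _ nx).
have mp D : measurable_fun D (fun x : R => (x `^ (z - 1))%:E).
  by apply/measurable_EFinP/measurable_funTS; exact: measurable_powR.
have : (\int[mu]_(x in F n) (x `^ (z - 1))%:E @[n --> \oo] -->
        \int[mu]_(x in \bigcup_n F n) (x `^ (z - 1))%:E)%E.
  apply: ge0_nondecreasing_set_cvg_integral => //.
  - move=> m n mn; rewrite subsetEset => x; rewrite /F /= !in_itv /= => /andP[mx ->].
    rewrite andbT (le_trans _ mx)// lef_pV2 ?posrE// ler_nat//.
  - by move=> n; exact: measurable_itv.
  - by move=> n; exact: mp.
  - by move=> n x _; rewrite lee_fin powR_ge0.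
rewrite -UF => cF.
apply: (cvge_to_le cF); apply: nearW => n; apply: integral_powR_itv => //.
by rewrite invr_gt0 ltr0n/= invf_lt1// ltr1n.
Qed.

(** Finiteness matters as much as positivity, because [fine] sends an infinite integral to 0. The
    integrand is dominated by x^(z-1) on (0, 1] and by e^(-x) beyond 1, and is at least e^(-1) on
    (0, 1]. *)
Lemma Gamma_gt0 z : 0 < z < 1 -> 0 < Gamma z.
Proof.
move=> /andP[z0 z1]; rewrite /Gamma.
set f := fun x : R => (x `^ (z - 1) * expR (- x))%:E.
have f0 x : (0 <= f x)%E by rewrite lee_fin mulr_ge0 ?powR_ge0 ?expR_ge0.
have mf D : measurable_fun D f.
  apply/measurable_EFinP/measurable_funTS; apply: measurable_funM.
    exact: measurable_powR.
  by apply: measurableT_comp; [exact: measurable_expR|exact: measurable_funN].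
have mp D : measurable_fun D (fun x : R => (x `^ (z - 1))%:E).
  by apply/measurable_EFinP/measurable_funTS; exact: measurable_powR.
have posE : [set x : R | (0 < x)%R] = `]0%R, 1%R] `|` `]1%R, +oo[.
  apply/seteqP; split => x /=; rewrite !in_itv /=.
    by move=> x0; have [x1|x1] := leP x 1; [left; rewrite x0|right].
  by move=> [/andP[]//|]; rewrite andbT; exact: lt_trans.
rewrite posE ge0_integral_setU//=; last first.
- rewrite disj_set2E; apply/eqP; rewrite -subset0 => x []/= /[!in_itv]/= /andP[_ x1].
  by rewrite andbT ltNge x1.
- by move=> x _; exact: f0.
- exact: mf.
have I1 : (\int[mu]_(x in `]0%R, 1%R]) f x <= (z^-1)%:E)%E.
  apply: le_trans (integral_powR_itv0 z0); apply: ge0_le_integral => //.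
  - exact: mf.
  - exact: mp.
  - move=> x /=; rewrite in_itv /= => /andP[x0 _]; rewrite lee_fin.
    by rewrite ler_piMr ?powR_ge0// expR_le1 oppr_le0 ltW.
have I2 : (\int[mu]_(x in `]1%R, +oo[) f x < +oo)%E.
  have := integrable_expR_normN (@ltr01 R) => /integrableP[mE].
  have mE' : measurable_fun setT (fun x : R => `|(expR (- (1 * `|x|)))%:E|%E).
    by apply: measurableT_comp.
  apply: le_lt_trans.
  apply: (@le_trans _ _ (\int[mu]_(x in `]1%R, +oo[) `|(expR (- (1 * `|x|)))%:E|)%E).
    apply: ge0_le_integral => //.
    - exact: mf.
    - by apply: measurable_funTS; exact: mE'.
    - move=> x /=; rewrite in_itv /= andbT => x1.
      rewrite lee_fin mul1r (gtr0_norm (lt_trans ltr01 x1)).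
      rewrite ger0_norm ?expR_ge0//.
      by rewrite ler_piMl ?expR_ge0// -[leRHS](powRr0 x); apply: ler_powR; lra.
  apply: ge0_subset_integral => //.
have I3 : ((expR (-1))%:E <= \int[mu]_(x in `]0%R, 1%R]) f x)%E.
  apply: (@le_trans _ _ (\int[mu]_(x in `]0%R, 1%R]) cst (expR (-1))%:E x)%E).
    by rewrite integral_cst//= /mu /= lebesgue_measure_itv /= lte_fin ltr01 sube0 mule1.
  apply: ge0_le_integral => //.
  - by move=> x _; rewrite lee_fin expR_ge0.
  - exact: mf.
  - move=> x /=; rewrite in_itv /= => x01; rewrite lee_fin.
    rewrite -[leLHS]mul1r ler_pM ?expR_ge0//; last by rewrite ler_expR; lra.
    by rewrite -[leLHS](powRr0 x); apply: ger_powR; lra.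
apply: fine_gt0; apply/andP; split.
  apply: (@lt_le_trans _ _ (\int[mu]_(x in `]0%R, 1%R]) f x)%E).
    by apply: lt_le_trans I3; rewrite lte_fin expR_gt0.
  by apply: leeDl; apply: integral_ge0 => x _; exact: f0.
by rewrite lte_add_pinfty// (le_lt_trans I1)// ltry.
Qed.

End Gamma.

(** * The nine covariances *)

Section Covariances.
Context {R : realType}.
Implicit Types (H K s t x : R) (f Cov : R -> R -> R).

Definition power_diag f :=
  exists c beta, beta < 2 /\ forall t, 0 <= t -> f t t = c * t `^ beta.

(** Injective families on finite types, rather than increasing sequences, make the notion
    independent of the order of the times. *)
Definition strict_pd f := forall (I : finType) (t : I -> R),
  injective t -> (forall i, 0 < t i) -> pd (fun i j => f (t i) (t j)).

Lemma strict_pdD f g : strict_pd f -> strict_pd g ->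
  strict_pd (fun s t => f s t + g s t).
Proof. by move=> hf hg I t t_inj t0; apply: pdD; [exact: hf|exact: hg]. Qed.

Lemma strict_pdZ c f : 0 < c -> strict_pd f -> strict_pd (fun s t => c * f s t).
Proof. by move=> c0 hf I t t_inj t0; apply: pdZ => //; exact: hf. Qed.

Lemma strict_pd_ext f g : (forall s t, 0 < s -> 0 < t -> f s t = g s t) ->
  strict_pd f -> strict_pd g.
Proof.
by move=> fg hf I t t_inj t0; apply: pd_ext (hf I t t_inj t0) => i j; exact: fg.
Qed.

(** This time change, with exponent 2H, reduces kernels in s^(2H) and t^(2H) to kernels in s and
    t. *)
Lemma strict_pd_powR f al : 0 < al -> strict_pd f ->
  strict_pd (fun s t => f (s `^ al) (t `^ al)).
Proof.
move=> al0 hf I t t_inj t0; apply: (hf I (fun i => t i `^ al)) => [i j|i].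
  by move=> /(powR_injective al0) E; apply/t_inj/E; rewrite nnegrE ltW.
exact: powR_gt0.
Qed.

Lemma quad_mx n (k : 'I_n -> 'I_n -> R) (a : 'cV[R]_n) :
  (a^T *m (\matrix_(i, j) k i j) *m a) ord0 ord0 = quad k (fun i => a i ord0).
Proof.
rewrite mxE /quad exchange_big; apply: eq_bigr => j _ /=.
rewrite mxE mulr_suml; apply: eq_bigr => i _; rewrite !mxE; ring.
Qed.

Lemma power_diag_strict_pd_spec Cov f : agrees Cov f ->
  power_diag f -> strict_pd f ->
  (exists c beta : R, 0 < c /\ beta < 2 /\
     forall t : R, 0 <= t -> Cov t t <= c * t `^ beta)
  /\
  (forall (n : nat) (t : 'I_n -> R), (0 < n)%N ->
     (forall i, 0 < t i) ->
     (forall i j : 'I_n, (i < j)%N -> t i < t j) ->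
     pos_def (\matrix_(i < n, j < n) Cov (t i) (t j))).
Proof.
move=> Cf [c [beta [beta2 fE]]] fpd; split.
  (* [power_diag] leaves the sign of c open; this constant is positive and dominates c. *)
  exists (`|c| + 1), beta; split; first by rewrite ltr_wpDl.
  split=> // t t0; rewrite Cf// fE// ler_wpM2r ?powR_ge0//.
  by rewrite (le_trans (ler_norm c))// lerDl.
move=> n t _ t0 t_mono a a0; rewrite quad_mx.
have t_inj : injective t.
  move=> i j tij; apply: val_inj.
  by have [/t_mono|/t_mono|//] := ltngtP (i : nat) (j : nat); rewrite tij ltxx.
have : pd (fun i j => Cov (t i) (t j)).
  by apply: pd_ext (fpd _ t t_inj t0) => i j; rewrite Cf// ltW.
apply; apply: contrapT => h; move/eqP: a0; apply; apply/matrixP => i j.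
rewrite ord1 mxE; have [//|ai] := eqVneq (a i ord0) 0.
by exfalso; apply: h; exists i.
Qed.

Lemma powR_double x al : 0 <= x -> (x + x) `^ al = 2 `^ al * x `^ al.
Proof. by move=> x0; rewrite -powRM//; congr powR; ring. Qed.

Lemma powR_dist0 s al : 0 < al -> `|s - s| `^ al = 0.
Proof. by move=> al0; rewrite subrr normr0 powR0// gt_eqF. Qed.

(** * Variances as multiples of powers of time *)

Lemma R1_diag H K : 0 < H * K < 1 -> power_diag (R1 H K).
Proof.
move=> HK; rewrite /R1; case: (K < 1).
  exists (Gamma (1 - K) / (K * (2 - K)) * (2 - 2 `^ K)), (2 * H * K); split; first lra.
  move=> t t0; rewrite powR_double ?powR_ge0// !powRrM.
  by move: (2 `^ K) (_ `^ K) => a b; ring.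
exists (Gamma (2 - K) / (K * (K - 1)) * (2 `^ K - 2)), (2 * H * K); split; first lra.
move=> t t0; rewrite powR_double ?powR_ge0// !powRrM.
by move: (2 `^ K) (_ `^ K) => a b; ring.
Qed.

Lemma R2_diag H : 0 < H < 1 -> power_diag (R2 H).
Proof.
move=> H01; exists 1, (2 * H); split; first lra.
by move=> t t0; rewrite /R2 [X in _ - X]powR_dist0; [field|lra].
Qed.

Lemma R3_diag H : 0 < H < 1 -> power_diag (R3 H).
Proof.
move=> H01; exists (2 `^ (2 * H)), (2 * H); split; first lra.
by move=> t t0; rewrite /R3 powR_double// [X in _ - X]powR_dist0 ?subr0//; lra.
Qed.

Lemma R4_diag H : 0 < H < 1 -> power_diag (R4 H).
Proof.
move=> H01; exists (2 - 2^-1 * 2 `^ (2 * H)), (2 * H); split; first lra.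
move=> t t0; rewrite /R4 powR_double// [X in _ * (_ + X)]powR_dist0; last lra.
by move: (2 `^ _) (t `^ _) => a b; ring.
Qed.

Lemma R5_diag H : 0 < H < 2^-1 -> power_diag (R5 H).
Proof.
move=> H01; exists (2 `^ (2 * H) - 1), (2 * H); split; first lra.
by move=> t t0; rewrite /R5 maxxx powR_double// mulrBl mul1r.
Qed.

Lemma R6_diag H : 0 < H < 2^-1 -> power_diag (R6 H).
Proof.
move=> H01; exists 1, (2 * H); split; first lra.
by move=> t t0; rewrite /R6 maxxx [X in _ - X]powR_dist0 ?subr0 ?mul1r//; lra.
Qed.

Lemma R7_diag H K : 0 < H < 2^-1 -> power_diag (R7 H K).
Proof.
move=> H01; exists (2^-1 * (2 - K * 2 `^ (2 * H))), (2 * H); split; first lra.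
move=> t t0; rewrite /R7 powR_double// [X in _ - _ * X]powR_dist0; last lra.
by move: (2 `^ _) (t `^ _) => a b; ring.
Qed.

Lemma R8_diag H K : 0 < H * K < 1 -> power_diag (R8 H K).
Proof.
move=> HK; exists 1, (2 * H * K); split; first lra.
move=> t t0; rewrite /R8 (powR_double _ (powR_ge0 t _)) [X in _ - X]powR_dist0; last lra.
by rewrite subr0 -powRrM mulKf ?mul1r//.
Qed.

Lemma R9_diag H K : 0 < H * K < 1 -> power_diag (R9 H K).
Proof.
move=> HK; exists (2 `^ K - 2^-1 * 2 `^ (2 * H * K)), (2 * H * K); split; first lra.
move=> t t0; rewrite /R9 (powR_double _ (powR_ge0 t _)) (powR_double _ t0).
rewrite [X in _ * (_ + X)]powR_dist0; last lra.
rewrite -powRrM; move: (2 `^ K) (2 `^ _) (t `^ _) => a b d; ring.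
Qed.

(** * Strict positive definiteness, family by family *)

Lemma subadd_strict_pd al : 0 < al < 1 ->
  strict_pd (fun s t => s `^ al + t `^ al - (s + t) `^ al).
Proof. by move=> al01 I t t_inj t0; have [] := subadd_pd_schur al01 t_inj t0. Qed.

Lemma superadd_strict_pd al : 1 < al < 2 ->
  strict_pd (fun s t => (s + t) `^ al - s `^ al - t `^ al).
Proof. by move=> al12 I t t_inj t0; exact: superadd_pd. Qed.

Lemma R1_pd H K : 0 < H -> 0 < K < 1 \/ 1 < K < 2 -> strict_pd (R1 H K).
Proof.
move=> H0 [K01|K12]; have H20 : 0 < 2 * H by lra.
  have c0 : 0 < Gamma (1 - K) / (K * (2 - K)).
    by rewrite divr_gt0 ?Gamma_gt0 ?mulr_gt0//; lra.
  apply: strict_pd_ext (strict_pdZ c0 (strict_pd_powR H20 (subadd_strict_pd K01))) => s t _ _.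
  by rewrite /R1 ifT ?(powRrM _ (2 * H) K)//; lra.
have c0 : 0 < Gamma (2 - K) / (K * (K - 1)).
  by rewrite divr_gt0 ?Gamma_gt0 ?mulr_gt0//; lra.
apply: strict_pd_ext (strict_pdZ c0 (strict_pd_powR H20 (superadd_strict_pd K12))) => s t _ _.
by rewrite /R1 ifF ?(powRrM _ (2 * H) K)//; apply/negbTE; rewrite -leNgt; lra.
Qed.

Lemma R2_pd H : 0 < H < 1 -> strict_pd (R2 H).
Proof.
move=> H01 I t t_inj t0; have al02 : 0 < 2 * H < 2 by lra.
have [/(@pdZ _ _ 2^-1) p _] := fbm_pd_schur al02 t_inj t0.
by apply: pd_ext (p _) => [i j|]; rewrite ?invr_gt0// /R2 distrC.
Qed.

Lemma R3_pd H : 0 < H < 1 -> strict_pd (R3 H).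
Proof.
move=> H01 I t t_inj t0; have al02 : 0 < 2 * H < 2 by lra.
have [p _] := odd_fbm_pd_schur al02 t_inj t0.
by apply: pd_ext p => i j; rewrite /R3 distrC addrC [t j + _]addrC addrC.
Qed.

Lemma R4_pd H : 0 < H < 1 -> strict_pd (R4 H).
Proof.
move=> H01 I t t_inj t0; have al02 : 0 < 2 * H < 2 by lra.
have [p _] := sub_fbm_pd_schur al02 t_inj t0.
apply: pd_ext p => i j; rewrite /R4 /sub_fbm [t j + t i]addrC; ring.
Qed.

Lemma R5_pd H : 0 < H < 2^-1 -> strict_pd (R5 H).
Proof.
move=> H01 I t t_inj t0; have al01 : 0 < 2 * H < 1 by lra.
exact: add_max_pd.
Qed.

Lemma R6_pd H : 0 < H < 2^-1 -> strict_pd (R6 H).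
Proof.
move=> H01 I t t_inj t0; have al01 : 0 < 2 * H < 1 by lra.
by apply: pd_ext (max_dist_pd al01 t_inj t0) => i j; rewrite /R6 distrC.
Qed.

(* The kernel is affine in K: it interpolates between fractional Brownian motion
   at K = 0 and the kernel of item 1 at K = 1. *)
Lemma R7_pd H K : 0 < H < 2^-1 -> 0 < K < 1 -> strict_pd (R7 H K).
Proof.
move=> H01 K01; have al01 : 0 < 2 * H < 1 by lra.
have H1 : 0 < H < 1 by lra.
have K1 : 0 < 1 - K by lra.
have K2 : 0 < K / 2 by lra.
apply: strict_pd_ext (strict_pdD (strict_pdZ K1 (R2_pd H1))
  (strict_pdZ K2 (subadd_strict_pd al01))) => s t _ _.
by rewrite /R2 /R7 (distrC t s); field.
Qed.

Lemma bifractional_pd H K : 0 < H < 1 -> 0 < K < 1 ->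
  strict_pd (fun s t => (s `^ (2 * H) + t `^ (2 * H)) `^ K - `|t - s| `^ (2 * H * K)).
Proof.
move=> H01 K01 I t t_inj t0; have al02 : 0 < 2 * H < 2 by lra.
have [p s] := fbm_pd_schur al02 t_inj t0.
have := powR_comp_pd K01 (fun i => powR_ge0 (t i) (2 * H))
  (fun i j => powR_ge0 `|t i - t j| (2 * H)) p s.
by apply: pd_ext => i j; rewrite (powRrM _ (2 * H) K) distrC.
Qed.

(** Here d_ij = (t_i + t_j)^(2H), so the inner kernel is [subadd]; this is where 2H < 1 enters. *)
Lemma bifractional_add_pd H K : 0 < H < 2^-1 -> 0 < K < 1 ->
  strict_pd (fun s t => (s `^ (2 * H) + t `^ (2 * H)) `^ K - (t + s) `^ (2 * H * K)).
Proof.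
move=> H01 K01 I t t_inj t0; have al01 : 0 < 2 * H < 1 by lra.
have [p s] := subadd_pd_schur al01 t_inj t0.
have := powR_comp_pd K01 (fun i => powR_ge0 (t i) (2 * H))
  (fun i j => powR_ge0 (t i + t j) (2 * H)) p s.
by apply: pd_ext => i j; rewrite (powRrM _ (2 * H) K) [t j + _]addrC.
Qed.

Lemma R8_pd H K : 0 < H < 1 -> 0 < K < 1 \/ 1 < K < 2 -> 0 < H * K < 1 ->
  strict_pd (R8 H K).
Proof.
move=> H01 HK HK01; have c0 : 0 < (2 `^ K)^-1 :> R by rewrite invr_gt0 powR_gt0.
suff h : strict_pd (fun s t =>
    (s `^ (2 * H) + t `^ (2 * H)) `^ K - `|t - s| `^ (2 * H * K)).
  apply: strict_pd_ext (strict_pdZ c0 h) => s t _ _.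
  by rewrite /R8 (addrC (t `^ _)) distrC.
case: HK => [K01|K12]; first exact: bifractional_pd.
have H20 : 0 < 2 * H by lra.
have two0 : 0 < (2 : R) by [].
(* Adding and subtracting s^(2HK) + t^(2HK) splits off twice a fractional Brownian covariance of
   index HK. *)
apply: strict_pd_ext (strict_pdD (strict_pd_powR H20 (superadd_strict_pd K12))
  (strict_pdZ two0 (R2_pd HK01))) => s t _ _.
by rewrite /R2 !mulrA -!powRrM; field.
Qed.

(** For K > 1 the kernel is a superadditive part plus the sub-fractional kernel of index HK; for K <
    1 it is the average of the two kernels [bifractional_pd] and [bifractional_add_pd] treat. *)
Lemma R9_pd H K :
  (0 < H < 1 /\ 1 < K < 2 /\ 0 < H * K < 1) \/ (0 < H < 2^-1 /\ 0 < K < 1) ->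
  strict_pd (R9 H K).
Proof.
move=> [[H01 [K12 HK01]]|[H01 K01]].
  have H20 : 0 < 2 * H by lra.
  apply: strict_pd_ext (strict_pdD (strict_pd_powR H20 (superadd_strict_pd K12))
    (R4_pd HK01)) => s t _ _.
  by rewrite /R4 /R9 !mulrA -!powRrM [t + s]addrC (addrC (s `^ (2 * H))); ring.
have half0 : 0 < 2^-1 :> R by [].
have H1 : 0 < H < 1 by lra.
apply: strict_pd_ext (strict_pdD (strict_pdZ half0 (bifractional_pd H1 K01))
  (strict_pdZ half0 (bifractional_add_pd H01 K01))) => s t _ _.
by rewrite /R9 (addrC (s `^ _)) (addrC t s) (distrC t s); field.
Qed.

End Covariances.

Theorem theorem1p1 (R : realType) (Cov : R -> R -> R) :
  cov_family Cov ->
  (exists c beta : R, 0 < c /\ beta < 2 /\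
     forall t : R, 0 <= t -> Cov t t <= c * t `^ beta)
  /\
  (forall (n : nat) (t : 'I_n -> R), (0 < n)%N ->
     (forall i, 0 < t i) ->
     (forall i j : 'I_n, (i < j)%N -> t i < t j) ->
     pos_def (\matrix_(i < n, j < n) Cov (t i) (t j))).
Proof.
rewrite /cov_family /in01; case=> [[H [K [H01 [HK [HK01 E]]]]]|].
  apply: power_diag_strict_pd_spec E (R1_diag HK01) (R1_pd _ HK); lra.
case=> [[H [H01 E]]|].
  exact: power_diag_strict_pd_spec E (R2_diag H01) (R2_pd H01).
case=> [[H [H01 E]]|].
  exact: power_diag_strict_pd_spec E (R3_diag H01) (R3_pd H01).
case=> [[H [H01 E]]|].
  exact: power_diag_strict_pd_spec E (R4_diag H01) (R4_pd H01).
case=> [[H [H01 E]]|].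
  exact: power_diag_strict_pd_spec E (R5_diag H01) (R5_pd H01).
case=> [[H [H01 E]]|].
  exact: power_diag_strict_pd_spec E (R6_diag H01) (R6_pd H01).
case=> [[H [K [H01 [K01 E]]]]|].
  exact: power_diag_strict_pd_spec E (R7_diag K H01) (R7_pd H01 K01).
case=> [[H [K [H01 [HK [HK01 E]]]]]|].
  exact: power_diag_strict_pd_spec E (R8_diag HK01) (R8_pd H01 HK HK01).
(* In the second parameter range HK < 1 follows from H < 1/2 and K < 1; it bounds the exponent of
   the variance. *)
move=> [H [K [HK E]]]; have HK01 : 0 < H * K < 1.
  case: HK => [[_ []//]|[H01 K01]].
  by apply/andP; split; [apply: mulr_gt0; lra|nra].
exact: power_diag_strict_pd_spec E (R9_diag HK01) (R9_pd HK).
Qed.
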